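(* Consider a Markov decision process $(r,\Gamma,\beta,P)$ with state space $\mathsf X$ and action space $\mathsf A$ satisfying the standing assumptions described in the context, and let $\sigma\in\Sigma$. If $P_\sigma$ is open set irreducible and $\sigma$ is continuous (as a map $\mathsf X\to\mathsf A$), then the following three statements are equivalent: (E1) there exists $x\in\mathsf X$ such that $v_s(x)\le v_\sigma(x)$ for all $s\in\Sigma$; (E2) there exists a Borel probability measure $\rho$ on $\mathsf X$ such that $\int v_s\,\mathrm d\rho\le\int v_\sigma\,\mathrm d\rho$ for all $s\in\Sigma$; (E3) $\sigma$ is an optimal policy, i.e. $v_\sigma(x)=v^*(x)$ for all $x\in\mathsf X$.
   Context: $\mathsf X$ and $\mathsf A$ are metric spaces; $b\mathsf X$ is the space of bounded Borel measurable functions $\mathsf X\to\mathbb R$ (supremum norm, pointwise order), $cb\mathsf X$ the continuous ones. A Markov decision process is a tuple $(r,\Gamma,\beta,P)$ where: $\beta\in(0,1)$; $\Gamma$ is a nonempty, compact-valued, continuous correspondence from $\mathsf X$ to $\mathsf A$; with $\mathsf G=\{(x,a): a\in\Gamma(x)\}$, $r:\mathsf G\to\mathbb R$ is bounded and continuous; for each $(x,a)\in\mathsf G$, $P(x,a,\cdot)$ is a Borel probability measure on $\mathsf X$, and $(x,a)\mapsto\int v(x')P(x,a,\mathrm dx')$ is continuous on $\mathsf G$ for every $v\in cb\mathsf X$. $\Sigma$ is the set of Borel measurable $\sigma:\mathsf X\to\mathsf A$ with $\sigma(x)\in\Gamma(x)$ for all $x$. For $\sigma\in\Sigma$, $r_\sigma(x)=r(x,\sigma(x))$,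 $P_\sigma(x,\mathrm dx')=P(x,\sigma(x),\mathrm dx')$ with Markov operator $(P_\sigma f)(x)=\int f(x')P_\sigma(x,\mathrm dx')$, $P_\sigma^n$ the $n$-step kernel, and $v_\sigma=\sum_{t\ge0}(\beta P_\sigma)^t r_\sigma$. The value function is $v^*(x)=\sup_{s\in\Sigma}v_s(x)$; $\sigma$ is optimal if $v_\sigma=v^*$ on $\mathsf X$. For a transition kernel $Q$ on $\mathsf X$, $y$ is $Q$-reachable from $x$ if for every open neighborhood $G$ of $y$ there is $n\in\mathbb N=\{1,2,\dots\}$ with $Q^n(x,G)>0$; $Q$ is open set irreducible if every $y\in\mathsf X$ is $Q$-reachable from every $x\in\mathsf X$. *)

(* Defs.v *)
From HB Require Import structures.
From mathcomp Require Import all_boot all_order all_algebra.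
From mathcomp Require Import all_classical all_reals all_analysis.
Set Implicit Arguments.
Unset Strict Implicit.
Unset Printing Implicit Defensive.
Import Order.TTheory GRing.Theory Num.Theory.
Import numFieldNormedType.Exports.
Local Open Scope classical_set_scope.
Local Open Scope ring_scope.

#[short(type="pointedMetricType")]
HB.structure Definition PointedMetric (K : numDomainType) :=
  { M of Metric K M & Pointed M }.

Definition borel (T : ptopologicalType) := g_sigma_algebraType (@open T).

Section MDP.
Context {R : realType} (X A : pointedMetricType R).

Notation BX := (borel X).
Notation BA := (borel A).

Definition uhc (Gam : X -> set A) :=
  forall x (U : set A), open U -> Gam x `<=` U ->
    \forall y \near x, Gam y `<=` U.
Definition lhc (Gam : X -> set A) :=
  forall x (U : set A), open U -> Gam x `&` U !=set0 ->
    \forall y \near x, Gam y `&` U !=set0.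
Definition continuous_corr (Gam : X -> set A) := uhc Gam /\ lhc Gam.

Definition graph (Gam : X -> set A) : set (X * A) :=
  [set p | Gam p.1 p.2].

Definition MDP (r : X -> A -> R) (Gam : X -> set A) (beta : R)
  (P : X -> A -> probability BX R) : Prop :=
  [/\ 0 < beta < 1,
      (forall x, Gam x !=set0) /\ (forall x, compact (Gam x)),
      continuous_corr Gam,
      (exists M, forall x a, Gam x a -> `|r x a| <= M) /\
        {within graph Gam, continuous (fun p : X * A => r p.1 p.2)} &
      forall v : X -> R, continuous v -> (exists M, forall x, `|v x| <= M) ->
        {within graph Gam,
          continuous (fun p : X * A => \int[P p.1 p.2]_(y in [set: BX]) v y)}].

Definition policy (Gam : X -> set A) (s : X -> A) : Prop :=
  measurable_fun [set: BX] (s : BX -> BA) /\ forall x, Gam x (s x).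

Definition Pop (P : X -> A -> probability BX R) (s : X -> A) (f : X -> R)
  : X -> R := fun x => \int[P x (s x)]_(y in [set: BX]) f y.

Definition Pn (P : X -> A -> probability BX R) (s : X -> A) (n : nat)
  (x : X) (B : set X) : R := iter n (Pop P s) (\1_B) x.

Definition vpol (r : X -> A -> R) (beta : R) (P : X -> A -> probability BX R)
  (s : X -> A) : X -> R :=
  fun x => limn (fun n => \sum_(t < n)
                   beta ^+ t * iter t (Pop P s) (fun y => r y (s y)) x).

Definition vstar (r : X -> A -> R) (Gam : X -> set A) (beta : R)
  (P : X -> A -> probability BX R) : X -> R :=
  fun x => sup [set vpol r beta P s x | s in policy Gam].

Definition optimal (r : X -> A -> R) (Gam : X -> set A) (beta : R)
  (P : X -> A -> probability BX R) (s : X -> A) : Prop :=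
  forall x, vpol r beta P s x = vstar r Gam beta P x.

Definition reachable (P : X -> A -> probability BX R) (s : X -> A) (x y : X) :=
  forall G : set X, open G -> G y -> exists n : nat, (0 < n)%N /\ 0 < Pn P s n x G.

Definition open_set_irreducible (P : X -> A -> probability BX R) (s : X -> A) :=
  forall x y, reachable P s x y.

End MDP.

(* Main.v *)
Require Import Defs.
From mathcomp Require Import finmap all_boot all_order all_algebra.
From mathcomp Require Import all_classical all_reals all_analysis.
From mathcomp Require wochoice.
From mathcomp Require Import measurable_realfun ring lra.
Set Implicit Arguments.
Unset Strict Implicit.
Unset Printing Implicit Defensive.
Import Order.TTheory GRing.Theory Num.Theory.
Import numFieldNormedType.Exports.
Local Open Scope classical_set_scope.
Local Open Scope ring_scope.

(** Let [u] be the value of the continuous policy [sigma]; it is a continuous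
    function. If some pair [(y, a)] of the graph satisfies
    [r y a + beta * P u (y, a) > u y], lower hemicontinuity gives an open set
    [G] around [y] on which the one-step reward-to-go can be improved by a
    fixed amount. Use a measurable improving selection there and [sigma]
    elsewhere: the resulting policy [s] satisfies
    [vpol s - u >= beta * P_s (vpol s - u)], hence [vpol s >= u], and since
    [sigma] reaches [G] from every state, [vpol s > u] everywhere. This
    contradicts (E2). So [u] dominates its Bellman update, and therefore the
    value of every policy.

    The spaces are not assumed separable, so the measurability of
    [x |-> f (x, s x)], for [f] continuous on the graph and [s] a policy, and
    the existence of measurable selections are not standard. Metric spaces have
    sigma-discrete bases and [Gam] is compact-valued and upper hemicontinuous,
    so countably many families of open rectangles, each with pairwise disjoint
    sides, contain arbitrarily thin neighbourhoods of the points of the graph.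
    The remaining difficulty is that a union of Borel sets lying in disjoint
    open sets may fail to be Borel when their Borel classes are unbounded. A
    diagonal argument reduces to unions of continuum many pieces, and these are
    Borel because countably many functions separate the indices of the pieces.
    For selections, one refines [Gam x] successively along the families of
    rectangles, until a single point remains. *)

(** * Discrete families in metric spaces *)

Definition discrete_family (T : topologicalType) (I : Type) (V : I -> set T) :=
  forall x : T, exists N, nbhs x N /\ is_subset1 [set i | V i `&` N !=set0].

Lemma discrete_family_trivIset (T : topologicalType) (I : Type)
    (V : I -> set T) : discrete_family V -> trivIset setT V.
Proof.
move=> dV i j _ _ [x [Vix Vjx]]; have [N [/nbhs_singleton Nx N1]] := dV x.
by apply: N1; exists x.
Qed.

Lemma discrete_family_near_compact (T : ptopologicalType) (I : Type)
    (V : I -> set T) (K : set T) : discrete_family V -> compact K ->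
  exists2 U, open U /\ K `<=` U & finite_set [set i | V i `&` U !=set0].
Proof.
move=> /choice[N NP]; rewrite compact_cover.
move=> /(_ _ K (fun x => (N x)^°)) [||D _ KD].
- by move=> x _; exact: open_interior.
- by move=> x Kx; exists x => //; exact: (NP x).1.
exists (cover [set` D] (fun x => (N x)^°)).
  by split=> //; apply: bigcup_open => x _; exact: open_interior.
apply: (@sub_finite_set _ _
  (\bigcup_(x in [set` D]) [set i | V i `&` N x !=set0])).
  move=> i [y [Viy [x Dx /interior_subset Nxy]]].
  by exists x => //; exists y.
apply: bigcup_finite => [|x _]; first exact: finite_fset.
have [[i Vi]|/forallNP noV] := pselect (exists i, V i `&` N x !=set0).
  by apply: (sub_finite_set _ (finite_set1 i)) => j Vj; exact: (NP x).2.
by apply: (sub_finite_set _ (@finite_set0 I)) => j /noV.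
Qed.

Section metric.
Context {R : realType} (M : metricType R).

Lemma metric_ball_open (x : M) (e : R) : open (ball x e).
Proof.
rewrite openE => y; rewrite ballEmdist /= => xy.
rewrite /interior; apply/nbhs_ballP; exists (e - mdist x y).
  by rewrite /= subr_gt0.
move=> z; rewrite ballEmdist /= ltrBrDl.
exact: le_lt_trans (metric_triangle _ _ _).
Qed.

(* Stone's construction: [x] is a center of [i] if [i] is the first index, for
   a well-ordering, whose set contains [x]. Centers of distinct indices whose
   balls of radius [3 r] stay inside their sets are at distance at least
   [3 r]. *)
Lemma metric_sigma_discrete_refinement (I : eqType) (U : I -> set M) :
  (forall i, open (U i)) -> (forall x, exists i, U i x) ->
  exists V : nat -> I -> set M,
    [/\ forall n i, open (V n i), forall n i, V n i `<=` U i,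
        forall n, discrete_family (V n) & forall x, exists n i, V n i x].
Proof.
move=> oU Ucover; have [le wo_le] := wochoice.well_ordering_principle I.
have le_anti : antisymmetric le.
  have := @wochoice.wo_chain_antisymmetric I le predT (wochoice.withinW wo_le).
  by move=> anti i j; exact: anti.
pose center i c := U i c /\ forall j, U j c -> le i j.
have center_ex x : exists i, center i x.
  have [|i [[/asboolP Uix imin] _]] := wo_le [pred i | `[< U i x >]].
    by have [i Uix] := Ucover x; exists i; apply/asboolP.
  by exists i; split=> // j Ujx; apply: imin; exact/asboolP.
pose r n : R := n.+1%:R^-1; have r_gt0 n : 0 < r n by rewrite /r.
pose core n i := [set c | center i c /\ ball c (3 * r n) `<=` U i].
exists (fun n i => \bigcup_(c in core n i) ball c (r n)); split.
- by move=> n i; apply: bigcup_open => c _; exact: metric_ball_open.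
- move=> n i x [c [_ cU]] cx; apply: cU; apply: le_ball cx.
  by have := r_gt0 n; lra.
- move=> n x; exists (ball x (r n / 2)); split.
    by apply: nbhsx_ballx; rewrite divr_gt0.
  move=> i j [y [[c [[Uic imin] cU] cy] xy]] [z [[d [[Ujd jmin] dU] dz] xz]].
  have cd : mdist c d < 3 * r n.
    move: cy xy dz xz; rewrite !ballEmdist /= => cy xy dz xz.
    have := metric_triangle c y d; have := metric_triangle y x d.
    have := metric_triangle x z d; rewrite (metric_sym y x) (metric_sym z d).
    by lra.
  apply: le_anti; rewrite imin ?jmin //.
    by apply: cU; rewrite ballEmdist.
  by apply: dU; rewrite ballEmdist /= metric_sym.
- move=> x; have [i ix] := center_ex x.
  have /nbhs_ballP[e /= e0 eU] : nbhs x (U i).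
    by apply: open_nbhs_nbhs; split; case: ix.
  have [n] : exists n, 0 + n.+1%:R^-1 < e / 3 by apply: ltr_add_invr; lra.
  rewrite add0r -/(r n) => re; exists n, i, x; last exact: ballxx.
  by split=> //; apply: subset_trans eU; apply: le_ball; lra.
Qed.

Lemma metric_sigma_discrete_base : exists V : nat * nat -> M -> set M,
  [/\ forall q i, open (V q i), forall q, discrete_family (V q) &
      forall (x : M) (e : R), 0 < e ->
        exists q i, V q i x /\ V q i `<=` ball x e].
Proof.
pose r n : R := n.+1%:R^-1; have r_gt0 n : 0 < r n by rewrite /r.
have /choice[V VP] n := metric_sigma_discrete_refinement
  (fun x => metric_ball_open x (r n))
  (fun x => ex_intro (fun c => ball c (r n) x) x (ballxx x (r_gt0 n))).
exists (fun q => V q.1 q.2); split=> [[n m]|[n m]|x e e0] /=.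
- by have [oV _ _ _] := VP n; exact: oV.
- by have [_ _ dV _] := VP n; exact: dV.
- have [n] : exists n, 0 + n.+1%:R^-1 < e / 2 by apply: ltr_add_invr; lra.
  rewrite add0r -/(r n) => re.
  have [_ Vball _ /(_ x)[m [i Vix]]] := VP n; exists (n, m), i; split=> // y.
  move=> /Vball; move/Vball: Vix; rewrite !ballEmdist /= => ix iy.
  by have := metric_triangle x i y; rewrite (metric_sym x i); lra.
Qed.

End metric.

(** * Borel sets lying in disjoint open sets *)

Inductive borel_code :=
  | Atom
  | Complement of borel_code
  | Union of nat -> borel_code.

(* The code describes a Borel subset of [nat -> Prop]; the branches of a union
   read disjoint sets of coordinates. *)
Fixpoint holds (v : nat -> Prop) (c : borel_code) : Prop :=
  match c with
  | Atom => v 0%N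
  | Complement d => ~ holds v d
  | Union f => exists k, holds (fun n => v (pickle (k, n))) (f k)
  end.

(* The labels of the nodes of the tree underlying a code are countably many
   functions that separate the codes. *)
Fixpoint node_label (c : borel_code) (p : seq nat) : nat :=
  match c, p with
  | Atom, _ => 0%N
  | Complement _, [::] => 1%N
  | Complement d, _ :: q => node_label d q
  | Union _, [::] => 2%N
  | Union f, k :: q => node_label (f k) q
  end.

Lemma node_label_inj : injective node_label.
Proof.
elim=> [|d IH|f IH] [|d'|f'] eq_label //;
  have := congr1 (@^~ [::]) eq_label => //= _.
- congr Complement; apply: IH; apply/funext => p.
  exact: (congr1 (@^~ (0%N :: p)) eq_label).
- congr Union; apply/funext => k; apply: IH; apply/funext => p.
  exact: (congr1 (@^~ (k :: p)) eq_label).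
Qed.

Section borel_sets.
Context (T : ptopologicalType).

Lemma open_borel (U : set T) : open U -> measurable (U : set (borel T)).
Proof. by move=> oU; exact: sub_sigma_algebra. Qed.

Lemma closed_borel (C : set T) : closed C -> measurable (C : set (borel T)).
Proof.
move=> cC; rewrite -(setCK C); apply: measurableC.
by apply: open_borel; rewrite openC.
Qed.

Lemma holds_borel (U : nat -> set T) c : (forall n, open (U n)) ->
  measurable ([set x | holds (U ^~ x) c] : set (borel T)).
Proof.
elim: c U => [|d IH|f IH] U oU /=.
- by apply: open_borel; exact: oU.
- by apply: (@measurableC _ (borel T)); exact: IH.
- rewrite (_ : mkset _ =
      \bigcup_k [set x | holds (fun n => U (pickle (k, n)) x) (f k)]).
    by apply: (@bigcupT_measurable _ (borel T)) => k; exact: IH.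
  by apply/seteqP; split=> x [k]; [exists k|move=> _ kx; exists k].
Qed.

Lemma borel_has_code (B : set T) : measurable (B : set (borel T)) ->
  exists c (U : nat -> set T),
    (forall n, open (U n)) /\ B = [set x | holds (U ^~ x) c].
Proof.
move: B; apply: smallest_sub; last by move=> U oU; exists Atom, (fun=> U).
split=> [|B [c [U [oU ->]]]|B /choice[c /choice[U UP]]].
- by exists Atom, (fun=> set0); split=> // n; exact: open0.
- by exists (Complement c), U; rewrite setTD.
exists (Union c), (fun m => if unpickle m is Some (k, n) then U k n else set0).
split=> [m|].
  by case: unpickle => [[k n]|]; [exact: (UP k).1|exact: open0].
apply/seteqP; split=> [x [k _]|x /= [k]].
  rewrite (UP k).2 => kx; exists k; congr holds: kx.
  by apply/funext => n; rewrite pickleK.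
move=> kx; exists k => //; rewrite (UP k).2; congr holds: kx.
by apply/funext => n; rewrite pickleK.
Qed.

(* If no single code described all the pieces, choosing for each code a piece
   that it does not describe would give a family whose union is Borel, hence
   has a code, and that code describes all the chosen pieces. *)
Lemma disjoint_bigcup_borel (J : Type) (W B : J -> set T) :
  (forall j, open (W j)) -> trivIset setT W ->
  (forall f : borel_code -> J,
    measurable (\bigcup_(j in range f) (W j `&` B j) : set (borel T))) ->
  measurable (\bigcup_j (W j `&` B j) : set (borel T)).
Proof.
move=> oW dW mB.
have same i j x : W i x -> W j x -> i = j.
  by move=> Wi Wj; apply: dW => //; exists x.
pose describes c j := exists U : nat -> set T,
  (forall n, open (U n)) /\ W j `&` B j = W j `&` [set x | holds (U ^~ x) c].
have [c /choice[U UP]] : exists c, forall j, describes c j.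
  apply: contrapT => /forallNP no_code.
  have /choice[f fP] c : exists j, ~ describes c j by apply/existsNP.
  have [c [U [oU cE]]] := borel_has_code (mB f).
  apply: (fP c); exists U; split=> //; rewrite -cE.
  apply/seteqP; split=> x [Wx]; first by move=> Bx; split=> //; exists (f c).
  by move=> [j _ [Wj Bj]]; split=> //; rewrite (same _ _ _ Wx Wj).
pose V n := \bigcup_j (W j `&` U j n).
have local j x : W j x -> U j ^~ x = V ^~ x.
  move=> Wx; apply/funext => n; apply/propext; split=> [Ux|[i _ [Wi Ui]]].
    by exists j.
  by rewrite (same _ _ _ Wx Wi).
suff -> : \bigcup_j (W j `&` B j) =
    (\bigcup_j W j) `&` [set x | holds (V ^~ x) c].
  apply: (@measurableI _ (borel T)).
    by apply: open_borel; apply: bigcup_open.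
  apply: holds_borel => n; apply: bigcup_open => j _; apply: openI => //.
  exact: (UP j).1.
rewrite setI_bigcupl; apply: eq_bigcupr => j _; rewrite (UP j).2.
by apply/seteqP; split=> x [Wx] /=; rewrite (local j).
Qed.

End borel_sets.

(* Think of [W] and [B] as two partial functions with values in [J] and [I],
   along which every set has a measurable preimage; the conclusion is that the
   set where the second equals [e] of the first is measurable. Its complement is
   a countable union because [h] separates the values of [e]. *)
Lemma bigcup_matching_measurable d (T : measurableType d) (J I : Type)
    (K : countType) (D : set J) (W : J -> set T) (B : I -> set T) (e : J -> I)
    (h : I -> K -> nat) :
  (forall E, measurable (\bigcup_(j in E) W j)) -> trivIset setT W ->
  (forall E, measurable (\bigcup_(i in E) B i)) -> trivIset setT B ->
  (forall j k, D j -> D k -> h (e j) = h (e k) -> e j = e k) ->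
  measurable (\bigcup_(j in D) (W j `&` B (e j))).
Proof.
move=> mW dW mB dB h_inj.
pose mismatch k m := (\bigcup_(j in [set j | h (e j) k = m]) W j) `&`
  \bigcup_(i in [set i | h i k <> m]) B i.
suff -> : \bigcup_(j in D) (W j `&` B (e j)) =
    ((\bigcup_(j in D) W j) `&` \bigcup_(i in e @` D) B i) `\`
    \bigcup_k \bigcup_m mismatch k m.
  apply: measurableD; first exact: measurableI.
  apply: countable_bigcupT_measurable => // k.
  by apply: bigcupT_measurable => m; exact: measurableI.
apply/seteqP; split=> [x [j Dj [Wj Bj]]|].
  split; first by split; [exists j|exists (e j) => //; exists j].
  move=> [k _ [m _ [[j' /= hj' Wj'] [i /= hi Bi]]]]; apply: hi.
  have -> : i = e j by apply: dB => //; exists x.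
  by have -> : j = j' by apply: dW => //; exists x.
move=> x [[[j Dj Wj] [_ [j' Dj' <-] Bj']]] no_mismatch.
exists j => //; split=> //.
suff -> : e j = e j' by [].
apply: h_inj => //; apply/funext => k; apply: contrapT => hk.
apply: no_mismatch; exists k => //; exists (h (e j) k) => //.
split; first by exists j.
by exists (e j') => //= /esym.
Qed.

Lemma bigcup_rectangle_preimage_borel (T S : ptopologicalType) (J I : Type)
    (s : T -> S) (W : J -> set T) (V : I -> set S) (e : J -> I) :
  measurable_fun [set: borel T] (s : borel T -> borel S) ->
  (forall j, open (W j)) -> trivIset setT W ->
  (forall i, open (V i)) -> trivIset setT V ->
  measurable (\bigcup_j (W j `&` s @^-1` V (e j)) : set (borel T)).
Proof.
move=> ms oW dW oV dV.
apply: (disjoint_bigcup_borel (B := fun j => s @^-1` V (e j))) => // f.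
have /choice[code codeP] i : exists c, (exists c', e (f c') = i) -> e (f c) = i.
  by have [[c ci]|no_code] := pselect (exists c', e (f c') = i);
    [exists c|exists Atom].
apply: (@bigcup_matching_measurable _ (borel T) _ _ (seq nat) _ _
  (fun i => s @^-1` V i) _ (node_label \o code)) => //.
- by move=> E; apply: open_borel; apply: bigcup_open.
- move=> E; rewrite -preimage_bigcup -[_ @^-1` _]setTI; apply: ms => //.
  by apply: open_borel; apply: bigcup_open.
- by move=> i j _ _ [x [Vi Vj]]; apply: dV => //; exists (s x).
- move=> _ _ [c _ <-] [c' _ <-] /node_label_inj same_code.
  by rewrite -(codeP (e (f c))) ?same_code ?codeP; [|exists c'|exists c].
Qed.

(** * Compact-valued upper hemicontinuous correspondences *)

Section upper_hemicontinuous.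
Context {R : realType} (X A : pointedMetricType R) (Gam : X -> set A).
Hypothesis Gam_uhc : uhc Gam.
Hypothesis Gam_compact : forall x, compact (Gam x).

Lemma uhc_tube (W : set (X * A)) x0 : open W ->
  (forall a, Gam x0 a -> W (x0, a)) ->
  \forall x \near x0, forall a, Gam x a -> W (x, a).
Proof.
move=> oW GamW.
pose ball_sub d a := forall x b, ball x0 d x -> ball a d b -> W (x, b).
have tube : \forall d \near 0^'+, Gam x0 `<=` ball_sub d.
  apply: (compact_near_coveringP _).1 => // a /GamW Wa.
  have /nbhs_ballP[e /= e0 eW] : nbhs (x0, a) W by exact: open_nbhs_nbhs.
  have e2 : 0 < e / 2 by rewrite divr_gt0.
  near=> a' d => x b xd bd.
  have de : d <= e by near: d; exact: nbhs_right_le.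
  have de2 : d <= e / 2 by near: d; exact: nbhs_right_le.
  have aa' : ball a (e / 2) a' by near: a'; exact: nbhsx_ballx.
  apply: (eW (x, b)); split; first exact: le_ball xd.
  by rewrite /= (splitr e); apply: ball_triangle aa' (le_ball de2 bd).
have [d [d_gt0 dW]] := filter_ex (filterI (nbhs_right_gt 0) tube).
have oU : open (\bigcup_(a in Gam x0) ball a d).
  by apply: bigcup_open => a _; exact: metric_ball_open.
have GamU : Gam x0 `<=` \bigcup_(a in Gam x0) ball a d.
  by move=> a Ga; exists a => //; exact: ballxx.
apply: filterS2 (Gam_uhc oU GamU) (nbhsx_ballx x0 d d_gt0) => x xU xd b.
by move=> /xU[a Ga ab]; exact: (dW a Ga).
Unshelve. all: by end_near. Qed.

Lemma uhc_near_finite (I : eqType) (V : I -> set A) (x0 : X) :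
    discrete_family V ->
  exists s : seq I, \forall x \near x0, forall a i, Gam x a -> V i a -> i \in s.
Proof.
move=> dV; have [U [oU GamU] /finite_seqP[s sE]] :=
  discrete_family_near_compact dV (@Gam_compact x0).
exists s.
apply: filterS (Gam_uhc oU GamU) => x xU a i /xU Ua Vi.
by suff: [set` s] i by []; rewrite -sE; exists a.
Qed.

(* In the absence of separability, this replaces a countable base of the graph
   made of open rectangles. *)
Lemma uhc_rectangle_network :
  exists (W : nat -> X -> set X) (V : nat -> A -> set A) (e : nat -> X -> A),
  [/\ forall q j, open (W q j), forall q, trivIset setT (W q),
      forall q i, open (V q i), forall q, trivIset setT (V q) &
      forall x a (eps : R), Gam x a -> 0 < eps -> exists q j,
        [/\ W q j x, V q (e q j) a & V q (e q j) `<=` ball a eps]].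
Proof.
have [V [oV dV Vbase]] := metric_sigma_discrete_base A.
have /choice[s sP] (qx : (nat * nat) * X) : exists s : seq A,
    \forall x \near qx.2, forall a i, Gam x a -> V qx.1 i a -> i \in s.
  exact: uhc_near_finite.
pose N q x0 := [set x | forall a i, Gam x a -> V q i a -> i \in s (q, x0)]^°.
have /choice[W WP] q := @metric_sigma_discrete_refinement _ X X (N q)
  (fun=> @open_interior _ _) (fun x => ex_intro _ x (sP (q, x))).
pose decode n : (nat * nat) * nat * nat := odflt (0, 0, 0, 0)%N (unpickle n).
exists (fun n => let: (q, l, _) := decode n in W q l),
  (fun n => let: (q, _, _) := decode n in V q),
  (fun n j => let: (q, _, k) := decode n in nth point (s (q, j)) k).
split=> [n j|n|n i|n|x a eps Ga eps0].
- by case: decode => -[q l] k; have [oW _ _ _] := WP q; exact: oW.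
- case: decode => -[q l] k; have [_ _ dW _] := WP q.
  exact: discrete_family_trivIset.
- by case: decode => -[q l] k; exact: oV.
- by case: decode => -[q l] k; exact: discrete_family_trivIset.
have [q [i [Via Vball]]] := Vbase a eps eps0.
have [_ WN _ /(_ x)[l [j Wx]]] := WP q.
have i_in_s : i \in s (q, j) by exact: (interior_subset (WN _ _ _ Wx)) Ga Via.
exists (pickle (q, l, index i (s (q, j)))), j; rewrite /decode pickleK /=.
by rewrite nth_index.
Qed.

Lemma policy_open_borel (s : X -> A) (O : set (X * A)) : policy Gam s ->
  open O -> measurable ([set x | O (x, s x)] : set (borel X)).
Proof.
move=> [ms sG] oO.
have [W [V [e [oW dW oV dV network]]]] := uhc_rectangle_network.
pose inO q i := [set x | forall a, V q i a -> O (x, a)]^°.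
suff -> : [set x | O (x, s x)] = \bigcup_q \bigcup_j
    ((W q j `&` inO q (e q j)) `&` s @^-1` V q (e q j)).
  apply: (@bigcupT_measurable _ (borel X)) => q.
  apply: bigcup_rectangle_preimage_borel => //.
    by move=> j; apply: openI => //; exact: open_interior.
  exact: trivIset_setIr.
apply/seteqP; split=> x /=; last first.
  by move=> [q _ [j _ [[_ /interior_subset Ox] /Ox]]].
move=> Ox; have : nbhs (x, s x) O by exact: open_nbhs_nbhs.
move=> /nbhs_ballP[d /= d0 dO].
have [q [j [Wx Vsx Vd]]] := network x _ d (sG x) d0.
exists q => //; exists j => //; split=> //; split=> //.
apply/nbhs_ballP; exists d => //= y xy a Va.
by apply: (dO (y, a)); split=> //; exact: Vd.
Qed.

End upper_hemicontinuous.

(** * Measurable selections *)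

Section hits.
Context {X A : Type}.

Definition hits (K : X -> set A) (L : set (X * A)) : set X :=
  [set x | exists2 a, K x a & L (x, a)].

Definition prefer (K : X -> set A) (L : set (X * A)) (x : X) : set A :=
  [set a | K x a /\ (hits K L x -> L (x, a))].

Lemma hits_prefer K L L' :
  hits (prefer K L) L' = hits K (L `&` L') `|` (~` hits K L `&` hits K L').
Proof.
apply/seteqP; split=> x.
  move=> [a [Ka pref_a] L'a]; have [KL|noKL] := pselect (hits K L x).
    by left; exists a => //; split=> //; exact: pref_a.
  by right; split=> //; exists a.
by case=> [[a Ka [La L'a]]|[noKL [a Ka L'a]]]; exists a => //; split.
Qed.

Lemma prefer_neq0 K L x : K x !=set0 -> prefer K L x !=set0.
Proof.
move=> [a Ka]; have [[b Kb Lb]|noKL] := pselect (hits K L x); first by exists b.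
by exists a; split.
Qed.

Fixpoint prefer_iter (K : X -> set A) (L : nat -> set (X * A)) n : X -> set A :=
  if n is m.+1 then prefer (prefer_iter K L m) (L m) else K.

Lemma prefer_iter_le K L m n x : (m <= n)%N ->
  prefer_iter K L n x `<=` prefer_iter K L m x.
Proof.
move=> /subnKC <-; elim: (n - m)%N => [|k IH]; first by rewrite addn0.
by rewrite addnS; apply: subset_trans IH => a [].
Qed.

Lemma prefer_iter_neq0 K L n x : K x !=set0 -> prefer_iter K L n x !=set0.
Proof. by elim: n => //= n IH /IH; exact: prefer_neq0. Qed.

Lemma bigcap_prefer_iter_subset1 K L x :
  (forall a b, K x a -> K x b ->
    (forall n, L n (x, a) <-> L n (x, b)) -> a = b) ->
  is_subset1 (\bigcap_n prefer_iter K L n x).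
Proof.
move=> sep a b Ka Kb; apply: sep => [||n]; [exact: (Ka 0%N)|exact: (Kb 0%N)|].
have [_ pref_a] := Ka n.+1 I; have [_ pref_b] := Kb n.+1 I.
by split=> [La|Lb]; [apply: pref_b; exists a|apply: pref_a; exists b] => //;
  [exact: (Ka n)|exact: (Kb n)].
Qed.

End hits.

Lemma prefer_closed (X A : topologicalType) (K : X -> set A) L x :
  closed (K x) -> closed L -> closed (prefer K L x).
Proof.
move=> cK cL; have [KL|noKL] := pselect (hits K L x).
  rewrite (_ : prefer K L x = K x `&` (fun a => (x, a)) @^-1` L).
    apply: closedI => //; apply: preimage_closed => // a _.
    by apply: cvg_pair => /=; [exact: cvg_cst|exact: cvg_id].
  by apply/seteqP; split=> a [Ka La]; split=> //; exact: La.
rewrite (_ : prefer K L x = K x) //.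
by apply/seteqP; split=> a; [case|split].
Qed.

Lemma nested_compact_neq0 (T : topologicalType) (K : nat -> set T) :
  compact (K 0%N) -> (forall n, closed (K n)) -> (forall n, K n !=set0) ->
  (forall m n, (m <= n)%N -> K n `<=` K m) -> \bigcap_n K n !=set0.
Proof.
move=> cptK cK /choice[u Ku] K_decr.
have [|a [_ a_cluster]] := cptK (u @ \oo) _.
  by exists 0%N => // n _; exact: K_decr (Ku n).
exists a => n _; apply: cK => B aB; apply: a_cluster aB.
by exists n => // m nm; exact: K_decr (Ku m).
Qed.

Section selection.
Context {R : realType} (X A : pointedMetricType R) (Gam : X -> set A).
Hypothesis Gam_uhc : uhc Gam.
Hypothesis Gam_compact : forall x, compact (Gam x).
Hypothesis Gam_neq0 : forall x, Gam x !=set0.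

Lemma hits_closed (L : set (X * A)) : closed L -> closed (hits Gam L).
Proof.
move=> cL; rewrite -openC openE => x0 /= noL.
have : \forall x \near x0, forall a, Gam x a -> (~` L) (x, a).
  apply: uhc_tube => //; first by rewrite openC.
  by move=> a Ga La; apply: noL; exists a.
by apply: filterS => x noLx [a Ga La]; exact: noLx La.
Qed.

Section separating.
Variable L : nat -> set (X * A).
Hypothesis L_closed : forall n, closed (L n).
Hypothesis L_separating : forall x a b, Gam x a -> Gam x b ->
  (forall n, L n (x, a) <-> L n (x, b)) -> a = b.

Let K := prefer_iter Gam L.

Lemma hits_prefer_iter_borel n (C : set (X * A)) : closed C ->
  measurable (hits (K n) C : set (borel X)).
Proof.
elim: n C => [|n IH] C cC; first by apply: closed_borel; exact: hits_closed.
rewrite [K _]/(prefer (K n) (L n)) hits_prefer.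
apply: (@measurableU _ (borel X)); first by apply: IH; exact: closedI.
apply: (@measurableI _ (borel X)); last exact: IH.
by apply: (@measurableC _ (borel X)); exact: IH.
Qed.

Lemma prefer_iter_bigcapI_neq0 x (C : set A) : closed C ->
  (forall n, K n x `&` C !=set0) -> \bigcap_n (K n x `&` C) !=set0.
Proof.
move=> cC KC; apply: nested_compact_neq0 => //.
- exact: compact_closedI.
- move=> n; apply: closedI => //; elim: n => [|n IH]; last exact: prefer_closed.
  by apply: compact_closed => //; exact: metric_hausdorff.
- by move=> m n mn; apply: setSI; exact: prefer_iter_le.
Qed.

Lemma separating_selection : exists2 s, policy Gam s &
  forall x, hits Gam (L 0%N) x -> L 0%N (x, s x).
Proof.
have /choice[s sK] x : exists a, (\bigcap_n K n x) a.
  have [n|a Ka] := @prefer_iter_bigcapI_neq0 x setT closedT.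
    by rewrite setIT; exact: prefer_iter_neq0.
  by exists a => n _; have [] := Ka n I.
have s_uniq x a : (\bigcap_n K n x) a -> a = s x.
  by move=> Ka; apply: (bigcap_prefer_iter_subset1 (@L_separating x)).
have ms (C : set A) : closed C -> measurable (s @^-1` C : set (borel X)).
  move=> cC; suff -> : s @^-1` C = \bigcap_n hits (K n) (setT `*` C).
    apply: (@bigcapT_measurable _ (borel X)) => n.
    apply: hits_prefer_iter_borel.
    by rewrite setTX; apply: preimage_closed => // p _; exact: cvg_snd.
  apply/seteqP; split=> x /=.
    by move=> Csx n _; exists (s x) => //; exact: sK.
  move=> hit; have [n|a Ka] := @prefer_iter_bigcapI_neq0 x C cC.
    by have [a Ka [_ Ca]] := hit n I; exists a.
  by rewrite -(s_uniq x a) => [|n _]; [have [] := Ka 0%N I|have [] := Ka n I].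
exists s; last by move=> x; have [_] := sK x 1%N I; exact.
split; last by move=> x; exact: (sK x 0%N).
apply: (@measurability _ _ (borel X) (borel A) _ s (@open A)) => //.
move=> _ [U oU <-]; rewrite setTI -(setCK U) preimage_setC.
have cU : closed (~` U) by rewrite closedC.
exact: (@measurableC _ (borel X) _ (ms _ cU)).
Qed.

End separating.

Lemma closed_selection (L : set (X * A)) : closed L -> exists2 s, policy Gam s &
  forall x, hits Gam L x -> L (x, s x).
Proof.
move=> cL.
have [W [V [e [oW dW oV dV network]]]] :=
  uhc_rectangle_network Gam_uhc Gam_compact.
pose O q := \bigcup_j (W q j `*` V q (e q j)).
pose L' n := if n is q.+1 then ~` O q else L.
apply: (@separating_selection L').
  case=> // q; rewrite closedC; apply: bigcup_open => j _.
  suff -> : W q j `*` V q (e q j) = fst @^-1` W q j `&` snd @^-1` V q (e q j).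
    by apply: openI; apply: open_comp => // p _;
      [exact: cvg_fst|exact: cvg_snd].
  by apply/seteqP; split.
move=> x a b Ga Gb sameL; apply: contrapT => /eqP ab.
have dist_gt0 : 0 < mdist a b by rewrite mdist_gt0.
have [q [j [Wx Va Vball]]] := network x a _ Ga dist_gt0.
have [_] := sameL q.+1; apply; last by exists j.
move=> [i _ [/= Wi Vb]]; have ij : i = j by apply: (dW q) => //; exists x.
by have := Vball b; rewrite -{1}ij ballEmdist /= ltxx => /(_ Vb).
Qed.

End selection.

(** * Integration of bounded measurable functions *)

Definition bounded_measurable {R : realType} d (T : measurableType d)
    (f : T -> R) :=
  measurable_fun [set: T] f /\ exists M, forall x, `|f x| <= M.

Section bounded_measurable.
Context {R : realType} d (T : measurableType d).
Implicit Types f g : T -> R.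

Lemma bounded_measurable_cst (c : R) : bounded_measurable (fun _ : T => c).
Proof. by split; [exact: measurable_cst|exists `|c|]. Qed.

Lemma bounded_measurableD f g : bounded_measurable f -> bounded_measurable g ->
  bounded_measurable (fun x => f x + g x).
Proof.
move=> [mf [M fM]] [mg [N gN]]; split; first exact: measurable_funD.
by exists (M + N) => x; rewrite (le_trans (ler_normD _ _)) // lerD.
Qed.

Lemma bounded_measurableZ (c : R) f : bounded_measurable f ->
  bounded_measurable (fun x => c * f x).
Proof.
move=> [mf [M fM]]; split; first exact: measurable_funM.
by exists (`|c| * M) => x; rewrite normrM ler_wpM2l.
Qed.

Lemma bounded_measurableB f g : bounded_measurable f -> bounded_measurable g ->
  bounded_measurable (fun x => f x - g x).
Proof.
move=> bf bg; have := bounded_measurableD bf (bounded_measurableZ (-1) bg).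
by under eq_fun do rewrite mulN1r.
Qed.

Lemma bounded_measurable_indic (B : set T) : measurable B ->
  bounded_measurable (\1_B : T -> R).
Proof.
move=> mB; split; first exact: measurable_indic.
by exists 1 => x; rewrite indicE; case: (_ \in _); rewrite ?normr1 ?normr0.
Qed.

Variable mu : probability T R.

Lemma bounded_measurable_integrable f : bounded_measurable f ->
  mu.-integrable [set: T] (EFin \o f).
Proof.
move=> [mf [M fM]]; apply: measurable_bounded_integrable => //.
  exact: fin_num_fun_lty.
exists M; split; first exact: num_real.
by move=> N MN x _ /=; apply: le_trans (fM x) _; exact: ltW.
Qed.

Lemma Rintegral_probability_cst (c : R) : \int[mu]_(x in [set: T]) c = c.
Proof. by rewrite Rintegral_cst //= probability_setT mulr1. Qed.

Lemma bounded_RintegralD f g : bounded_measurable f -> bounded_measurable g ->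
  \int[mu]_(x in [set: T]) (f x + g x) =
  \int[mu]_(x in [set: T]) f x + \int[mu]_(x in [set: T]) g x.
Proof.
by move=> bf bg; rewrite RintegralD //; exact: bounded_measurable_integrable.
Qed.

Lemma bounded_RintegralB f g : bounded_measurable f -> bounded_measurable g ->
  \int[mu]_(x in [set: T]) (f x - g x) =
  \int[mu]_(x in [set: T]) f x - \int[mu]_(x in [set: T]) g x.
Proof.
by move=> bf bg; rewrite RintegralB //; exact: bounded_measurable_integrable.
Qed.

Lemma bounded_RintegralZ (c : R) f : bounded_measurable f ->
  \int[mu]_(x in [set: T]) (c * f x) = c * \int[mu]_(x in [set: T]) f x.
Proof.
by move=> bf; rewrite RintegralZl //; exact: bounded_measurable_integrable.
Qed.

Lemma bounded_Rintegral_ge f c : bounded_measurable f ->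
  (forall x, c <= f x) -> c <= \int[mu]_(x in [set: T]) f x.
Proof.
move=> bf cf; rewrite -[leLHS]Rintegral_probability_cst.
by apply: le_Rintegral => //; apply: bounded_measurable_integrable => //;
  exact: bounded_measurable_cst.
Qed.

Lemma bounded_normr_Rintegral f M : bounded_measurable f ->
  (forall x, `|f x| <= M) -> `|\int[mu]_(x in [set: T]) f x| <= M.
Proof.
move=> bf fM; apply: le_trans (le_normr_Rintegral _ _) _ => //.
  exact: bounded_measurable_integrable.
rewrite -[leRHS]Rintegral_probability_cst.
apply: le_Rintegral => //; apply: bounded_measurable_integrable.
  split; first by apply: measurableT_comp => //; case: bf.
  by exists M => x; rewrite normr_id.
exact: bounded_measurable_cst.
Qed.

Lemma bounded_Rintegral_eq0_ae f : bounded_measurable f ->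
  (forall x, 0 <= f x) ->
  \int[mu]_(x in [set: T]) f x = 0 -> {ae mu, forall x, f x = 0}.
Proof.
move=> bf f0 intf0.
have f_abs : (\int[mu]_(x in [set: T]) `|(EFin \o f) x| = 0)%E.
  under eq_integral do rewrite /= ger0_norm //.
  by rewrite -[LHS]fineK ?[fine _]intf0 // integrable_fin_num //;
    exact: bounded_measurable_integrable.
have mf : measurable_fun [set: T] (EFin \o f).
  by apply/measurable_EFinP; case: bf.
have := (ae_eq_integral_abs mu measurableT mf).1 f_abs.
by apply: filterS => x /(_ I) [].
Qed.

Lemma bounded_Rintegral_support f g : bounded_measurable f ->
  bounded_measurable g -> (forall x, 0 <= f x) -> (forall x, 0 <= g x) ->
  (forall x, 0 < g x -> 0 < f x) ->
  \int[mu]_(x in [set: T]) f x = 0 -> \int[mu]_(x in [set: T]) g x = 0.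
Proof.
move=> bf bg f0 g0 gf /(bounded_Rintegral_eq0_ae bf f0) ae_f0.
rewrite -(Rintegral_probability_cst 0) /Rintegral; congr fine.
apply: ae_eq_integral => //; first by apply/measurable_EFinP; case: bg.
apply: filterS ae_f0 => x fx0 _ /=; congr EFin; apply/eqP.
by rewrite eq_le g0 andbT leNgt; apply/negP => /gf; rewrite fx0 ltxx.
Qed.

Lemma bounded_Rintegral_gt0 f : bounded_measurable f -> (forall x, 0 < f x) ->
  0 < \int[mu]_(x in [set: T]) f x.
Proof.
move=> bf f_gt0; rewrite lt0r Rintegral_ge0 ?andbT => [|x _]; last exact: ltW.
apply/eqP => intf0; have /eqP := Rintegral_probability_cst 1.
rewrite (bounded_Rintegral_support bf (bounded_measurable_cst 1)) //.
- by rewrite eq_sym oner_eq0.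
- by move=> x; exact: ltW.
Qed.

End bounded_measurable.
Arguments bounded_measurable_cst {R d T} c.

Lemma Rintegral_dirac {R : realType} d (T : measurableType d) (f : T -> R) x :
  measurable_fun [set: T] f -> \int[@dirac _ T x R]_(y in [set: T]) f y = f x.
Proof.
move=> mf; rewrite /Rintegral integral_dirac ?diracT ?mul1e //.
exact/measurable_EFinP.
Qed.

(** * Measurable families of probability measures *)

Definition measurable_family {R : realType} d1 d2 (T1 : measurableType d1)
    (T2 : measurableType d2) (k : T1 -> probability T2 R) :=
  forall U, measurable U -> measurable_fun [set: T1] (fun x => k x U).

Lemma measurable_family_pi_system {R : realType} d1 d2 (T1 : measurableType d1)
    (T2 : measurableType d2) (k : T1 -> probability T2 R) (G : set (set T2)) :
  @measurable _ T2 = <<s G >> -> setI_closed G ->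
  (forall U, G U -> measurable_fun [set: T1] (fun x => k x U)) ->
  measurable_family k.
Proof.
move=> GE GI mkG U mU; move: (mU); rewrite GE; move: U {mU}.
apply: (dynkin_induction
  (P := [set U | measurable_fun [set: T1] (fun x => k x U)])) => //=.
- by under eq_fun do rewrite probability_setT; exact: measurable_cst.
- move=> B mB mkB; under eq_fun do rewrite probability_setC //.
  by apply: emeasurable_funB => //; exact: measurable_cst.
- move=> F mF tF mkF.
  have bigcup_sum x : k x (\bigcup_n F n) = (\sum_(n <oo) k x (F n))%E.
    by rewrite measure_semi_bigcup //; exact: bigcupT_measurable.
  under eq_fun do rewrite bigcup_sum.
  by apply: (ge0_emeasurable_sum (P := xpredT)) => n // _; exact: mkF.
Qed.

Lemma measurable_Rintegral_family {R : realType} d1 d2 (T1 : measurableType d1)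
    (T2 : measurableType d2) (k : T1 -> probability T2 R) (f : T2 -> R) :
  measurable_family k -> bounded_measurable f ->
  measurable_fun [set: T1] (fun x => \int[k x]_(y in [set: T2]) f y).
Proof.
move=> mk bf; have [mf [M fM]] := bf.
have fM_ge0 y : 0 <= f y + M by have := fM y; rewrite ler_norml => /andP[]; lra.
have -> : (fun x => \int[k x]_(y in [set: T2]) f y) =
    (fun x => fine (\int[k x]_(y in [set: T2]) (f y + M)%:E)%E - M).
  apply/funext => x; rewrite -[fine _]/(\int[k x]_(y in [set: T2]) (f y + M)).
  rewrite bounded_RintegralD //; last exact: bounded_measurable_cst.
  by rewrite Rintegral_probability_cst addrK.
apply: measurable_funB; last exact: measurable_cst.
apply: measurableT_comp => //.
apply: (measurable_fun_integral_kernel (l := fun x => k x)) => //.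
by apply/measurable_EFinP; exact: measurable_funD.
Qed.

Lemma preimage_open_borel_measurable {R : realType} (T : ptopologicalType)
    (f : T -> R) :
  (forall U, open U -> measurable (f @^-1` U : set (borel T))) ->
  measurable_fun [set: borel T] (f : borel T -> R).
Proof.
move=> mf; apply: (measurability _ (RGenOpens.measurableE R)).
move=> _ [_ [a [b ->] <-]]; rewrite setTI; apply: mf; exact: interval_open.
Qed.

Section set_dist.
Context {R : realType} (X : pointedMetricType R) (F : set X).

Definition set_dist (x : X) : R := inf [set mdist x y | y in F].

Let dist_lbound x : has_lbound [set mdist x y | y in F].
Proof. by exists 0 => _ [y _ <-]; exact: mdist_ge0. Qed.

Lemma set_dist_le x y : F y -> set_dist x <= mdist x y.
Proof. by move=> Fy; apply: ge_inf => //; exists y. Qed.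

Hypothesis F_neq0 : F !=set0.

Lemma set_dist_ge c x : (forall y, F y -> c <= mdist x y) -> c <= set_dist x.
Proof.
move=> cF; have [y Fy] := F_neq0.
by apply: lb_le_inf; [exists (mdist x y), y|move=> _ [z Fz <-]; exact: cF].
Qed.

Lemma set_dist_ge0 x : 0 <= set_dist x.
Proof. by apply: set_dist_ge => y _; exact: mdist_ge0. Qed.

Lemma set_dist_eq0 x : F x -> set_dist x = 0.
Proof.
by move=> Fx; apply/eqP; rewrite eq_le set_dist_ge0 -(mdistxx x) set_dist_le.
Qed.

Lemma set_dist_gt0 x : closed F -> ~ F x -> 0 < set_dist x.
Proof.
move=> cF nFx; have /nbhs_ballP[e /= e0 eF] : nbhs x (~` F).
  by apply: open_nbhs_nbhs; split=> //; rewrite openC.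
apply: lt_le_trans e0 _; apply: set_dist_ge => y Fy; rewrite leNgt; apply/negP.
by move=> xy; apply: (eF y) => //; rewrite ballEmdist.
Qed.

Lemma set_dist_triangle x y : set_dist x <= mdist x y + set_dist y.
Proof.
rewrite -lerBlDl; apply: set_dist_ge => z Fz; rewrite lerBlDl.
exact: le_trans (set_dist_le _ Fz) (metric_triangle _ _ _).
Qed.

Lemma set_dist_continuous : continuous set_dist.
Proof.
move=> x; apply/cvgrPdist_lt => e e0.
apply: filterS (nbhsx_ballx x e e0) => y; rewrite ballEmdist /= => xy.
have := set_dist_triangle x y; have := set_dist_triangle y x.
by rewrite (metric_sym y x) ltr_norml => yx_triangle xy_triangle; lra.
Qed.

End set_dist.

Lemma open_indic_approx {R : realType} (X : pointedMetricType R) (G : set X) :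
  open G -> exists v : nat -> X -> R,
  [/\ forall n, continuous (v n), forall n x, 0 <= v n x <= 1 &
      forall x, v n x @[n --> \oo] --> (\1_G x : R)].
Proof.
move=> oG; have [GC_neq0|GC0] := pselect (~` G !=set0); last first.
  exists (fun _ _ => 1); split=> [n x|n x|x].
  - exact: cvg_cst.
  - by rewrite ler01 lexx.
  rewrite indicE mem_set; first exact: cvg_cst.
  by apply: contrapT => nGx; apply: GC0; exists x.
exists (fun n x => Num.min 1 (n%:R * set_dist (~` G) x)); split=> [n x|n x|x].
- apply: (@continuous_min _ _ (fun=> 1) (fun x => n%:R * set_dist (~` G) x)).
    exact: cvg_cst.
  by apply: cvgM; [exact: cvg_cst|exact: set_dist_continuous].
- rewrite le_min ler01 ge_min lexx /= andbT.
  by rewrite mulr_ge0 // set_dist_ge0.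
rewrite indicE; have [/set_mem Gx|/negP nG] := boolP (x \in G); last first.
  rewrite set_dist_eq0 //; last by move=> Gx; apply: nG; exact: mem_set.
  under eq_fun do rewrite mulr0; rewrite minEle ler10 /=.
  exact: cvg_cst.
have d_gt0 : 0 < set_dist (~` G) x.
  by apply: set_dist_gt0 => //; rewrite closedC.
apply: cvg_near_cst; near=> n.
have dn : (set_dist (~` G) x)^-1 <= n%:R by near: n; exact: nbhs_infty_ger.
by rewrite minEle -ler_pdivrMr // div1r dn.
Unshelve. all: by end_near. Qed.

Lemma measurable_family_continuous_test {R : realType} d (T : measurableType d)
    (X : pointedMetricType R) (k : T -> probability (borel X) R) :
  (forall v : X -> R, continuous v -> (exists M, forall y, `|v y| <= M) ->
    measurable_fun [set: T] (fun x => \int[k x]_(y in [set: borel X]) v y)) ->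
  measurable_family k.
Proof.
move=> mkv.
apply: (@measurable_family_pi_system _ _ _ _ (borel X) _ (@open X)) => //.
  by move=> U V oU oV; exact: openI.
move=> G oG; have [v [cv v01 vG]] := open_indic_approx oG.
have bv n : bounded_measurable (v n : borel X -> R).
  split; last by exists 1 => x; have /andP[v0 v1] := v01 n x; rewrite ger0_norm.
  apply: preimage_open_borel_measurable => U oU; apply: open_borel.
  by have /continuousP := cv n; exact.
apply: (@emeasurable_fun_cvg _ T R setT
  (fun n x => \int[k x]_(y in [set: borel X]) (v n y)%:E)%E) => [n|x _].
  rewrite (_ : (fun _ => _) = EFin \o
      (fun x => \int[k x]_(y in [set: borel X]) v n y)).
    by apply/measurable_EFinP; apply: mkv => //; case: (bv n).
  apply/funext => x; rewrite /= fineK // integrable_fin_num //.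
  exact: (bounded_measurable_integrable _ (bv n)).
have mG := open_borel oG.
have -> : k x G = (\int[k x]_(y in [set: borel X]) (\1_G y)%:E)%E.
  by rewrite integral_indic // setIT.
apply: (@dominated_cvg _ _ _ _ _ _ _ _ (cst 1%E)) => //.
- by move=> n; apply/measurable_EFinP; case: (bv n).
- by move=> y _; apply: cvg_EFin; [near=> n|exact: vG].
- exact: (@bounded_measurable_integrable R _ (borel X) _ _
    (bounded_measurable_cst 1)).
- by move=> n y _; have /andP[v0 v1] := v01 n y; rewrite /= lee_fin ger0_norm.
Unshelve. all: by end_near. Qed.

(** * Discounted values of a Markov chain *)

Section discounted_series.
Context {R : realType} (beta : R).
Hypothesis beta01 : 0 < beta < 1.

Lemma le_geometric_eq0 (a C : R) : (forall n, `|a| <= C * beta ^+ n) -> a = 0.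
Proof.
have [beta_gt0 beta_lt1] := andP beta01 => aC; apply/eqP; rewrite -normr_le0.
have cvg0 : (C * beta ^+ n) @[n --> \oo] --> 0.
  by apply: cvg_geometric; rewrite gtr0_norm.
rewrite -(cvg_lim _ cvg0) //; apply: limr_ge; first exact: cvgP cvg0.
by apply: nearW => n; exact: aC.
Qed.

Variables (f : nat -> R) (M : R).
Hypothesis fM : forall t, `|f t| <= M.

Let S n := \sum_(t < n) beta ^+ t * f t.

Lemma discounted_sum_cvg : cvgn S.
Proof.
have [beta_gt0 beta_lt1] := andP beta01.
have -> : S = series (fun t => beta ^+ t * f t).
  by apply/funext => n; rewrite /S /series /= big_mkord.
apply: normed_cvg.
apply: (@series_le_cvg _ _ (geometric M beta)) => [n|n|n|] /=.
- exact: normr_ge0.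
- by rewrite mulr_ge0 ?exprn_ge0 ?(le_trans _ (fM 0%N)) // ltW.
- by rewrite normrM normrX gtr0_norm // mulrC ler_wpM2r // exprn_ge0 // ltW.
- by apply: is_cvg_geometric_series; rewrite gtr0_norm.
Qed.

Lemma discounted_sumB_le n k :
  `|S (n + k)%N - S n| <= M / (1 - beta) * (beta ^+ n - beta ^+ (n + k)).
Proof.
have [beta_gt0 beta_lt1] := andP beta01.
elim: k => [|k IH]; first by rewrite addn0 !subrr normr0 mulr0.
have -> : S (n + k.+1)%N - S n =
    S (n + k)%N - S n + beta ^+ (n + k) * f (n + k)%N.
  by rewrite addnS /S big_ord_recr /=; ring.
have -> : M / (1 - beta) * (beta ^+ n - beta ^+ (n + k.+1)) =
    M / (1 - beta) * (beta ^+ n - beta ^+ (n + k)) + beta ^+ (n + k) * M.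
  by rewrite addnS exprS; field; rewrite subr_eq0 eq_sym lt_eqF.
rewrite (le_trans (ler_normD _ _)) // lerD // normrM normrX gtr0_norm //.
by rewrite ler_wpM2l // exprn_ge0 // ltW.
Qed.

Lemma discounted_tail_le n : `|limn S - S n| <= M / (1 - beta) * beta ^+ n.
Proof.
have [beta_gt0 beta_lt1] := andP beta01.
have SBn_cvg : `|S m - S n| @[m --> \oo] --> `|limn S - S n|.
  by apply: cvg_norm; apply: cvgB; [exact: discounted_sum_cvg|exact: cvg_cst].
rewrite -(cvg_lim _ SBn_cvg) //; apply: limr_le.
  exact: cvgP SBn_cvg.
exists n => // m /= nm; rewrite -(subnKC nm).
apply: le_trans (discounted_sumB_le _ _) _; apply: ler_wpM2l.
  by rewrite divr_ge0 ?(le_trans _ (fM 0%N)) // subr_ge0 ltW.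
by rewrite gerBl exprn_ge0 // ltW.
Qed.

End discounted_series.

Definition markov_op {R : realType} d (T : measurableType d)
    (k : T -> probability T R) (f : T -> R) (x : T) : R :=
  \int[k x]_(y in [set: T]) f y.

Definition discounted_value {R : realType} d (T : measurableType d) (beta : R)
    (k : T -> probability T R) (g : T -> R) (x : T) : R :=
  limn (fun n => \sum_(t < n) beta ^+ t * iter t (markov_op k) g x).

Section discounted_value.
Context {R : realType} d (T : measurableType d).
Variables (beta : R) (k : T -> probability T R).
Hypothesis beta01 : 0 < beta < 1.
Hypothesis mk : measurable_family k.

Lemma markov_op_bounded_measurable (f : T -> R) :
  bounded_measurable f -> bounded_measurable (markov_op k f).
Proof.
move=> bf; split; first exact: measurable_Rintegral_family.
by have [_ [M fM]] := bf; exists M => x; exact: bounded_normr_Rintegral.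
Qed.

Lemma iter_markov_op_bounded_measurable (f : T -> R) n :
  bounded_measurable f -> bounded_measurable (iter n (markov_op k) f).
Proof.
by move=> bf; elim: n => // n IH; exact: markov_op_bounded_measurable.
Qed.

Lemma iter_markov_op_ge0 (f : T -> R) n x :
  (forall y, 0 <= f y) -> 0 <= iter n (markov_op k) f x.
Proof.
by move=> f0; elim: n x => // n IH x; apply: Rintegral_ge0 => y _; exact: IH.
Qed.

Lemma iter_markov_op_support (f g : T -> R) n x :
  bounded_measurable f -> bounded_measurable g ->
  (forall y, 0 <= f y) -> (forall y, 0 <= g y) ->
  (forall y, 0 < f y -> 0 < g y) ->
  (forall y, g y = 0 -> markov_op k g y = 0) ->
  0 < iter n (markov_op k) f x -> 0 < g x.
Proof.
move=> bf bg f0 g0 fg g_absorb; elim: n x => [|n IH] x; first exact: fg.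
move=> f_gt0; rewrite lt0r g0 andbT; apply/eqP => /g_absorb kg0.
move: f_gt0; rewrite iterS /markov_op (bounded_Rintegral_support bg) ?ltxx //.
- exact: iter_markov_op_bounded_measurable.
- by move=> y; exact: iter_markov_op_ge0.
Qed.

(* Iterating the inequality gives [f >= - M beta ^ n] for all [n]. *)
Lemma discounted_superharmonic_ge0 (f : T -> R) : bounded_measurable f ->
  (forall x, beta * markov_op k f x <= f x) -> forall x, 0 <= f x.
Proof.
move=> bf f_super; have [beta_gt0 _] := andP beta01; have [_ [M fM]] := bf.
have lower n x : - (M * beta ^+ n) <= f x.
  elim: n x => [|n IH] x.
    by rewrite expr0 mulr1; have := fM x; rewrite ler_norml => /andP[].
  apply: le_trans (f_super x); rewrite exprS mulrCA -mulrN ler_pM2l //.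
  exact: bounded_Rintegral_ge.
move=> x; rewrite leNgt; apply/negP => fx_lt0.
suff fx0 : f x = 0 by rewrite fx0 ltxx in fx_lt0.
apply: (le_geometric_eq0 beta01 (C := M)) => n.
by rewrite ltr0_norm // lerNl.
Qed.

Section reward.
Variables (g : T -> R) (M : R).
Hypothesis mg : measurable_fun [set: T] g.
Hypothesis gM : forall x, `|g x| <= M.

Local Notation v := (discounted_value beta k g).
Let S n x := \sum_(t < n) beta ^+ t * iter t (markov_op k) g x.

Let bg : bounded_measurable g. Proof. by split=> //; exists M. Qed.

Lemma iter_markov_op_bound t x : `|iter t (markov_op k) g x| <= M.
Proof.
elim: t x => [|t IH] x; first exact: gM.
apply: bounded_normr_Rintegral => //.
exact: iter_markov_op_bounded_measurable.
Qed.

Lemma discounted_partial_bounded_measurable n : bounded_measurable (S n).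
Proof.
elim: n => [|n IH]; rewrite /S.
  by under eq_fun do rewrite big_ord0; exact: bounded_measurable_cst.
under eq_fun do rewrite big_ord_recr /=.
apply: bounded_measurableD => //; apply: bounded_measurableZ.
exact: iter_markov_op_bounded_measurable.
Qed.

Lemma discounted_partialS n x : S n.+1 x = g x + beta * markov_op k (S n) x.
Proof.
elim: n => [|n IH].
  rewrite /S big_ord_recr big_ord0 /= add0r expr0 mul1r /markov_op.
  under eq_Rintegral do rewrite big_ord0.
  by rewrite Rintegral_probability_cst mulr0 addr0.
have opS : markov_op k (S n.+1) x =
    markov_op k (S n) x + beta ^+ n * iter n.+1 (markov_op k) g x.
  have b_iter := iter_markov_op_bounded_measurable n bg.
  rewrite /= {3}/markov_op -bounded_RintegralZ // -bounded_RintegralD.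
  - by apply: eq_Rintegral => y _; rewrite /S big_ord_recr.
  - exact: discounted_partial_bounded_measurable.
  - exact: bounded_measurableZ.
by rewrite opS /S big_ord_recr /= -/(S n.+1 x) IH exprS; ring.
Qed.

Lemma discounted_value_tail n x : `|v x - S n x| <= M / (1 - beta) * beta ^+ n.
Proof.
exact: (discounted_tail_le beta01 (fun t => iter_markov_op_bound t x)).
Qed.

Lemma discounted_value_bound x : `|v x| <= M / (1 - beta).
Proof.
by have := discounted_value_tail 0 x; rewrite /S big_ord0 subr0 mulr1.
Qed.

Lemma discounted_value_bounded_measurable : bounded_measurable v.
Proof.
split; last by exists (M / (1 - beta)); exact: discounted_value_bound.
apply: (@measurable_fun_cvg _ T R setT S) => [n|x _].
  by case: (discounted_partial_bounded_measurable n).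
exact: (discounted_sum_cvg beta01 (fun t => iter_markov_op_bound t x)).
Qed.

Lemma discounted_value_eq x : v x = g x + beta * markov_op k v x.
Proof.
have [beta_gt0 _] := andP beta01.
apply/eqP; rewrite -subr_eq0; apply/eqP.
apply: (le_geometric_eq0 beta01 (C := M / (1 - beta) * beta *+ 2)) => n.
have -> : v x - (g x + beta * markov_op k v x) =
    (v x - S n.+1 x) - beta * (markov_op k v x - markov_op k (S n) x).
  by rewrite discounted_partialS; ring.
have op_tail : `|markov_op k v x - markov_op k (S n) x| <=
    M / (1 - beta) * beta ^+ n.
  have bv := discounted_value_bounded_measurable.
  have bS := discounted_partial_bounded_measurable n.
  rewrite -bounded_RintegralB //; apply: bounded_normr_Rintegral => [|y].
    exact: bounded_measurableB.
  exact: discounted_value_tail.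
apply: le_trans (ler_normB _ _) _.
rewrite mulr2n mulrDl normrM (gtr0_norm beta_gt0).
rewrite lerD //; first by rewrite -mulrA -exprS; exact: discounted_value_tail.
by rewrite [leRHS]mulrAC [leRHS]mulrC ler_pM2l.
Qed.

End reward.
End discounted_value.

Lemma geometric_uniform_limit_continuous {R : realType} (T : topologicalType)
    (f_ : nat -> T -> R) (f : T -> R) (C beta : R) : `|beta| < 1 ->
  (forall n, continuous (f_ n)) ->
  (forall n x, `|f x - f_ n x| <= C * beta ^+ n) -> continuous f.
Proof.
move=> beta1 cf_ f_f.
apply: (@uniform_limit_continuous T R (f_ @ \oo) f).
  by exists 0%N => // n _; exact: cf_.
move=> P /uniform_nbhs[E [+ EP]]; rewrite -entourage_ballE => -[e /= e0 eE].
have Cbeta_cvg : (C * beta ^+ n) @[n --> \oo] --> 0 by exact: cvg_geometric.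
near=> n; apply: EP => y _; apply: eE; apply: le_lt_trans (f_f n y) _.
by near: n; exact: (cvgr_lt _ Cbeta_cvg).
Unshelve. all: by end_near. Qed.

Lemma discounted_value_continuous {R : realType} (X : pointedMetricType R)
    (beta : R) (k : borel X -> probability (borel X) R) (g : X -> R) (M : R) :
  0 < beta < 1 -> measurable_family k ->
  measurable_fun [set: borel X] (g : borel X -> R) ->
  (forall x, `|g x| <= M) -> continuous g ->
  (forall f : X -> R, continuous f -> (exists C, forall x, `|f x| <= C) ->
    continuous (markov_op k f : X -> R)) ->
  continuous (discounted_value beta k g : X -> R).
Proof.
move=> beta01 mk mg gM cg feller; have [beta_gt0 beta_lt1] := andP beta01.
have c_iter t : continuous (iter t (markov_op k) g : X -> R).
  elim: t => // t IH; apply: feller => //.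
  by exists M; exact: (iter_markov_op_bound mk mg gM).
apply: (@geometric_uniform_limit_continuous _ X
  (fun n x => \sum_(t < n) beta ^+ t * iter t (markov_op k) g x)
  _ (M / (1 - beta)) beta).
- by rewrite gtr0_norm.
- elim=> [|n IH] x.
    by under eq_fun do rewrite big_ord0; exact: cvg_cst.
  under eq_fun do rewrite big_ord_recr /=.
  apply: cvgD; first exact: IH.
  by apply: cvgM; [exact: cvg_cst|exact: c_iter].
- exact: (discounted_value_tail beta01 mk mg gM).
Qed.

(** * Policies *)

Lemma within_continuous_open (T S : topologicalType) (D : set T) (f : T -> S)
    (U : set S) : {within D, continuous f} -> open U ->
  exists2 W, open W & forall x, D x -> (W x <-> U (f x)).
Proof.
move=> /continuousP cf /cf /open_subspaceP[W oW WD]; exists W => // x Dx.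
have WU : (W `&` D) x = (f @^-1` U `&` D) x by rewrite WD.
split=> [Wx|Ux].
- by have [] : (f @^-1` U `&` D) x by rewrite -WU.
- by have [] : (W `&` D) x by rewrite WU.
Qed.

Section policies.
Context {R : realType} (X A : pointedMetricType R) (Gam : X -> set A).

Lemma policy_if (B : set X) (s s' : X -> A) : measurable (B : set (borel X)) ->
  policy Gam s -> policy Gam s' ->
  policy Gam (fun x => if x \in B then s x else s' x).
Proof.
move=> mB [ms sG] [ms' s'G]; split; last by move=> x; case: ifP.
apply: (@measurable_fun_ifT _ _ (borel X) (borel A) s s'
  (fun x => x \in B)) => //.
apply: (@measurable_fun_bool _ (borel X) _ _ true).
rewrite setTI (_ : _ @^-1` _ = B) //.
by apply/seteqP; split=> x /=; [move/set_mem|move/mem_set].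
Qed.

Lemma lhc_hits_open (O : set (X * A)) : lhc Gam -> open O -> open (hits Gam O).
Proof.
move=> Gam_lhc oO; rewrite openE => x [a Ga Oxa].
have /nbhs_ballP[e /= e0 eO] : nbhs (x, a) O by exact: open_nbhs_nbhs.
have Gam_ball : Gam x `&` ball a e !=set0.
  by exists a; split=> //; exact: ballxx.
have near_ball := Gam_lhc _ _ (metric_ball_open a e) Gam_ball.
apply: filterS2 near_ball (nbhsx_ballx x e e0) => y [b [Gb ab]] xy.
by exists b => //; exact: eO.
Qed.

Variable s : X -> A.
Hypothesis s_policy : policy Gam s.

Lemma policy_comp_measurable (f : X * A -> R) : uhc Gam ->
  (forall x, compact (Gam x)) -> {within graph Gam, continuous f} ->
  measurable_fun [set: borel X] ((fun x => f (x, s x)) : borel X -> R).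
Proof.
move=> Gam_uhc Gam_compact cf; apply: preimage_open_borel_measurable => U oU.
have [W oW WU] := within_continuous_open cf oU; have [_ sG] := s_policy.
suff -> : (fun x => f (x, s x)) @^-1` U = [set x | W (x, s x)].
  exact: policy_open_borel s_policy oW.
by apply/seteqP; split=> x /=; move/WU; apply; exact: sG.
Qed.

Lemma policy_comp_continuous (f : X * A -> R) : continuous s ->
  {within graph Gam, continuous f} -> continuous (fun x => f (x, s x)).
Proof.
move=> cs cf; apply/continuousP => U oU.
have [W oW WU] := within_continuous_open cf oU; have [_ sG] := s_policy.
have -> : (fun x => f (x, s x)) @^-1` U = (fun x => (x, s x)) @^-1` W.
  by apply/seteqP; split=> x /=; move/WU; apply; exact: sG.
apply: open_comp => // x _; apply: cvg_pair; [exact: cvg_id|exact: cs].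
Qed.

End policies.

(** * Values of policies *)

Definition qvalue {R : realType} (X A : pointedMetricType R) (r : X -> A -> R)
    (beta : R) (P : X -> A -> probability (borel X) R) (v : X -> R)
    (x : X) (a : A) : R :=
  r x a + beta * \int[P x a]_(y in [set: borel X]) v y.

Section mdp.
Context {R : realType} (X A : pointedMetricType R).
Variables (r : X -> A -> R) (Gam : X -> set A) (beta : R).
Variable P : X -> A -> probability (borel X) R.
Hypothesis mdp : MDP r Gam beta P.

Local Notation vp := (vpol r beta P).
Local Notation bounded_borel f := (bounded_measurable (f : borel X -> R)).
Local Notation kernel s :=
  ((fun x => P x (s x)) : borel X -> probability (borel X) R).

Lemma mdp_beta : 0 < beta < 1. Proof. by case: mdp. Qed.

Lemma mdp_uhc : uhc Gam. Proof. by case: mdp => _ _ []. Qed.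

Lemma mdp_lhc : lhc Gam. Proof. by case: mdp => _ _ []. Qed.

Lemma mdp_compact x : compact (Gam x). Proof. by case: mdp => _ []. Qed.

Lemma mdp_neq0 x : Gam x !=set0. Proof. by case: mdp => _ []. Qed.

Lemma mdp_reward_continuous :
  {within graph Gam, continuous (fun p : X * A => r p.1 p.2)}.
Proof. by case: mdp => _ _ _ []. Qed.

Lemma mdp_reward_bounded :
  exists M, forall s, policy Gam s -> forall x, `|r x (s x)| <= M.
Proof.
by case: mdp => _ _ _ [[M rM] _] _; exists M => s [_ sG] x; exact: rM.
Qed.

Lemma mdp_feller (v : X -> R) : continuous v ->
  (exists M, forall x, `|v x| <= M) ->
  {within graph Gam,
    continuous (fun p : X * A => \int[P p.1 p.2]_(y in [set: borel X]) v y)}.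
Proof. by case: mdp => _ _ _ _; apply. Qed.

Section policy_value.
Variable s : X -> A.
Hypothesis s_policy : policy Gam s.

Lemma policy_reward_measurable :
  measurable_fun [set: borel X] ((fun x => r x (s x)) : borel X -> R).
Proof.
exact: (policy_comp_measurable s_policy mdp_uhc mdp_compact
  mdp_reward_continuous).
Qed.

Lemma policy_kernel_measurable : measurable_family (kernel s).
Proof.
apply: (@measurable_family_continuous_test _ _ (borel X)) => v cv bv.
exact: (policy_comp_measurable s_policy mdp_uhc mdp_compact (mdp_feller cv bv)).
Qed.

Lemma vpol_bounded_measurable : bounded_borel (vp s).
Proof.
have [M rM] := mdp_reward_bounded.
exact: (discounted_value_bounded_measurable mdp_beta policy_kernel_measurable
  policy_reward_measurable (rM s s_policy)).
Qed.

Lemma vpol_eq x : vp s x = qvalue r beta P (vp s) x (s x).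
Proof.
have [M rM] := mdp_reward_bounded.
exact: (discounted_value_eq mdp_beta policy_kernel_measurable
  policy_reward_measurable (rM s s_policy)).
Qed.

Lemma vpol_continuous : continuous s -> continuous (vp s).
Proof.
move=> cs; have [M rM] := mdp_reward_bounded.
apply: (discounted_value_continuous mdp_beta policy_kernel_measurable
  policy_reward_measurable (rM s s_policy)) => [|f cf bf].
- exact: (policy_comp_continuous s_policy cs mdp_reward_continuous).
- exact: (policy_comp_continuous s_policy cs (mdp_feller cf bf)).
Qed.

Lemma Pop_superharmonic_ge0 (f : X -> R) : bounded_borel f ->
  (forall x, beta * Pop P s f x <= f x) -> forall x, 0 <= f x.
Proof.
exact: (discounted_superharmonic_ge0 (k := kernel s) mdp_beta).
Qed.

Lemma vpolB_eq (v : X -> R) x : bounded_borel v ->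
  vp s x - v x = qvalue r beta P v x (s x) - v x +
    beta * Pop P s (fun y => vp s y - v y) x.
Proof.
move=> bv; rewrite {1}vpol_eq /qvalue /Pop bounded_RintegralB //.
  by ring.
exact: vpol_bounded_measurable.
Qed.

Lemma vpol_le_supersolution (v : X -> R) : bounded_borel v ->
  (forall x, qvalue r beta P v x (s x) <= v x) -> forall x, vp s x <= v x.
Proof.
move=> bv v_super x; rewrite -subr_ge0; move: x.
have bvp := vpol_bounded_measurable.
apply: Pop_superharmonic_ge0 => [|x]; first exact: bounded_measurableB.
have := v_super x; have := vpolB_eq x bv.
by rewrite /Pop !bounded_RintegralB //; lra.
Qed.

Lemma vpol_ge_subsolution (v : X -> R) : bounded_borel v ->
  (forall x, v x <= qvalue r beta P v x (s x)) -> forall x, v x <= vp s x.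
Proof.
move=> bv v_sub x; rewrite -subr_ge0; move: x.
apply: Pop_superharmonic_ge0 => [|x].
  exact: bounded_measurableB vpol_bounded_measurable bv.
by rewrite [leRHS]vpolB_eq // lerDr subr_ge0.
Qed.

Lemma vpol_gt_subsolution (v : X -> R) x : bounded_borel v ->
  (forall y, v y <= qvalue r beta P v y (s y)) ->
  v x < qvalue r beta P v x (s x) -> v x < vp s x.
Proof.
move=> bv v_sub vx; rewrite -subr_gt0 vpolB_eq //.
have [beta_gt0 _] := andP mdp_beta.
rewrite ltr_wpDr ?subr_gt0 // mulr_ge0 ?(ltW beta_gt0) //.
by apply: Rintegral_ge0 => y _; rewrite subr_ge0; exact: vpol_ge_subsolution.
Qed.

End policy_value.

Lemma vpol_bounded :
  exists M, forall s, policy Gam s -> forall x, `|vp s x| <= M.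
Proof.
have [M rM] := mdp_reward_bounded; exists (M / (1 - beta)) => s s_policy.
exact: (discounted_value_bound mdp_beta (policy_kernel_measurable s_policy)
  (policy_reward_measurable s_policy) (rM s s_policy)).
Qed.

Lemma optimalP (sigma : X -> A) : policy Gam sigma ->
  optimal r Gam beta P sigma <->
  forall s, policy Gam s -> forall x, vp s x <= vp sigma x.
Proof.
move=> sigma_policy; have [M vM] := vpol_bounded.
split=> [opt s s_policy x|best x].
  rewrite opt; apply: ub_le_sup; last by exists s.
  exists M => _ [t t_policy <-].
  exact: le_trans (ler_norm _) (vM t t_policy x).
apply/eqP; rewrite eq_le; apply/andP; split.
  apply: ub_le_sup; last by exists sigma.
  by exists (vp sigma x) => _ [s s_policy <-]; exact: best.
apply: ge_sup; first by exists (vp sigma x), sigma.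
by move=> _ [s s_policy <-]; exact: best.
Qed.

(** * Policy improvement *)

Section improvement.
Variable sigma : X -> A.
Hypothesis sigma_policy : policy Gam sigma.

Local Notation u := (vp sigma).
Local Notation q := (qvalue r beta P u).

(* The policies [s] and [sigma] generate the same paths until [s] departs from
   [sigma], and at that moment a positive gain is made. *)
Lemma vpol_lt_reachable (s : X -> A) (G : set X) n x : policy Gam s -> open G ->
  (forall y, s y = sigma y \/ u y < q y (s y)) ->
  (forall y, G y -> u y < q y (s y)) ->
  0 < Pn P sigma n x G -> u x < vp s x.
Proof.
move=> s_policy oG improves improvesG reachG.
have bu := vpol_bounded_measurable sigma_policy.
have bs := vpol_bounded_measurable s_policy.
have u_sub y : u y <= q y (s y).
  by have [->|/ltW//] := improves y; rewrite -vpol_eq.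
rewrite -subr_gt0.
apply: (iter_markov_op_support (k := kernel sigma) (f := \1_G)
  (g := fun y => vp s y - u y) (policy_kernel_measurable sigma_policy)) reachG.
- by apply: bounded_measurable_indic; exact: open_borel.
- exact: bounded_measurableB.
- by move=> y; rewrite indicE.
- by move=> y; rewrite subr_ge0; exact: vpol_ge_subsolution.
- move=> y; rewrite indicE subr_gt0.
  have [/set_mem Gy _|_] := boolP (y \in G); last by rewrite ltxx.
  by apply: vpol_gt_subsolution => //; exact: improvesG.
move=> y /eqP; rewrite subr_eq0 => /eqP no_gain.
have [s_sigma|] := improves y; last first.
  by move=> /(vpol_gt_subsolution s_policy bu u_sub); rewrite no_gain ltxx.
have := vpolB_eq s_policy y bu; rewrite s_sigma -vpol_eq // no_gain subrr add0r.
move=> /esym/eqP; have [beta_gt0 _] := andP mdp_beta.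
by rewrite mulf_eq0 gt_eqF //= /Pop s_sigma => /eqP.
Qed.

Hypothesis sigma_continuous : continuous sigma.

Lemma qvalueB_continuous :
  {within graph Gam, continuous (fun p : X * A => q p.1 p.2 - u p.1)}.
Proof.
have cu := vpol_continuous sigma_policy sigma_continuous.
have [_ bu] := vpol_bounded_measurable sigma_policy.
move=> p; apply: cvgB.
  apply: cvgD; first exact: mdp_reward_continuous.
  by apply: cvgM; [exact: cvg_cst|exact: (mdp_feller cu bu)].
apply: continuous_subspaceT p => p.
by apply: (@continuous_comp _ _ _ fst u); [exact: cvg_fst|exact: cu].
Qed.

Lemma improving_policy y a : Gam y a -> u y < q y a ->
  exists (s : X -> A) (G : set X),
  [/\ policy Gam s, open G, G y,
      forall x, s x = sigma x \/ u x < q x (s x) &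
      forall x, G x -> u x < q x (s x)].
Proof.
move=> Ga uq; pose e := (q y a - u y) / 2.
have e0 : 0 < e by rewrite divr_gt0 // subr_gt0.
have gap_ya : e < q y a - u y.
  by rewrite ltr_pdivrMr // ltr_pMr ?subr_gt0 // ltr1n.
have [Wlt oWlt WltP] :=
  within_continuous_open qvalueB_continuous (@open_lt _ e).
have [Wgt oWgt WgtP] :=
  within_continuous_open qvalueB_continuous (@open_gt _ e).
have cWlt : closed (~` Wlt) by rewrite closedC.
have [t t_policy t_gap] :=
  closed_selection mdp_uhc mdp_compact mdp_neq0 cWlt.
pose B := hits Gam (~` Wlt); pose s x := if x \in B then t x else sigma x.
have B_improves x : B x -> u x < q x (s x).
  move=> Bx; rewrite /s mem_set //; have [_ tG] := t_policy.
  rewrite -subr_gt0; apply: lt_le_trans e0 _; rewrite leNgt; apply/negP.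
  by move=> /(WltP (x, t x) (tG x)); exact: t_gap.
exists s, (hits Gam Wgt); split.
- apply: policy_if => //; apply: closed_borel.
  exact: hits_closed mdp_uhc mdp_compact _ cWlt.
- exact: lhc_hits_open mdp_lhc oWgt.
- by exists a => //; apply/(WgtP (y, a)).
- move=> x; have [Bx|nBx] := pselect (B x); first by right; exact: B_improves.
  by left; rewrite /s memNset.
- move=> x [b Gb /(WgtP (x, b) Gb) /= gap_gt]; apply: B_improves.
  by exists b => // /(WltP (x, b) Gb) /=; rewrite ltNge ltW.
Qed.

Lemma average_optimal_supersolution (rho : probability (borel X) R) :
  open_set_irreducible P sigma ->
  (forall s, policy Gam s -> \int[rho]_(y in [set: borel X]) vp s y
                          <= \int[rho]_(y in [set: borel X]) u y) ->
  forall y a, Gam y a -> q y a <= u y.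
Proof.
move=> irreducible rho_opt y a Ga; rewrite leNgt; apply/negP => uq.
have [s [G [s_policy oG Gy improves improvesG]]] := improving_policy Ga uq.
have gain_gt0 x : 0 < vp s x - u x.
  have [n [_ reachG]] := irreducible x y G oG Gy.
  by rewrite subr_gt0; exact: vpol_lt_reachable reachG.
have bs := vpol_bounded_measurable s_policy.
have bu := vpol_bounded_measurable sigma_policy.
have := bounded_Rintegral_gt0 rho (bounded_measurableB bs bu) gain_gt0.
by rewrite bounded_RintegralB // subr_gt0 ltNge rho_opt.
Qed.

End improvement.
End mdp.

Theorem theorem4p2 (R : realType) (X A : pointedMetricType R)
  (r : X -> A -> R) (Gam : X -> set A) (beta : R)
  (P : X -> A -> probability (borel X) R) (sigma : X -> A) :
  MDP r Gam beta P ->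
  policy Gam sigma ->
  open_set_irreducible P sigma ->
  continuous sigma ->
  [<-> (exists x : X, forall s, policy Gam s ->
          vpol r beta P s x <= vpol r beta P sigma x);
       (exists rho : probability (borel X) R, forall s, policy Gam s ->
          \int[rho]_(y in [set: borel X]) vpol r beta P s y
          <= \int[rho]_(y in [set: borel X]) vpol r beta P sigma y);
       optimal r Gam beta P sigma].
Proof.
move=> mdp sigma_policy irreducible sigma_continuous; tfae.
- move=> [x x_opt]; exists (@dirac _ (borel X) x R) => s s_policy.
  have [ms _] := vpol_bounded_measurable mdp s_policy.
  have [msigma _] := vpol_bounded_measurable mdp sigma_policy.
  rewrite (@Rintegral_dirac _ _ (borel X) _ x ms).
  by rewrite (@Rintegral_dirac _ _ (borel X) _ x msigma); exact: x_opt.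
- move=> [rho rho_opt]; apply/(optimalP mdp) => // s s_policy.
  apply: (vpol_le_supersolution mdp s_policy) => [|x].
    exact: (vpol_bounded_measurable mdp sigma_policy).
  apply: (average_optimal_supersolution mdp sigma_policy sigma_continuous
    irreducible rho_opt).
  by case: s_policy.
- move=> /(optimalP mdp sigma_policy) opt; exists point => s s_policy.
  exact: opt.
Qed.
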